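(* Let $X\subset\mathbb{R}^{d_x}$ be a nonempty closed convex set and $Y\subset\mathbb{R}^{d_y}$ a nonempty compact set. Let $f:\mathbb{R}^{d_x}\times\mathbb{R}^{d_y}\to\mathbb{R}$ be continuous and such that, for every $y\in Y$, the function $\mathbb{R}^{d_x}\ni x\mapsto f(x,y)$ is coercive and convex. Put $W:=Y^{d_x+1}$ and, for $w=(y_1,\dots,y_{d_x+1})\in W$ and $x\in X$, put $$F(x,w):=\max_{1\le i\le d_x+1} f(x,y_i),\qquad G(w):=\min_{x\in X}F(x,w).$$ Then $$\min_{x\in X}\max_{y\in Y} f(x,y)=\max_{w\in W} G(w)=\max_{w\in W}\min_{x\in X}F(x,w).$$
   Context: The set $Y$ is not assumed convex and $y\mapsto f(x,y)$ is not assumed concave. Coercive means $f(x,y)\to+\infty$ as $\|x\|\to\infty$ with $y$ fixed. The equality includes the assertion that the optimal values written as min and max are attained. *)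

(* Defs.v *)
From HB Require Import structures.
From mathcomp Require Import all_boot all_order all_algebra.
From mathcomp Require Import boolp classical_sets reals topology normedtype.
From mathcomp Require Import convex.

Set Implicit Arguments.
Unset Strict Implicit.
Unset Printing Implicit Defensive.

Import Order.TTheory GRing.Theory Num.Theory.
Import numFieldNormedType.Exports.

Local Open Scope classical_set_scope.
Local Open Scope ring_scope.

Definition attains_max (R : realType) (T : Type) (A : set T) (g : T -> R) :=
  exists2 a, A a & forall b, A b -> g b <= g a.

Definition attains_min (R : realType) (T : Type) (A : set T) (g : T -> R) :=
  exists2 a, A a & forall b, A b -> g a <= g b.

(* Because [sup] and [inf] are total, [max_over A g] and [min_over A g] are
   the maximum and minimum of g on A only together with [attains_max A g] and
   [attains_min A g] respectively. *)
Definition max_over (R : realType) (T : Type) (A : set T) (g : T -> R) : R :=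
  sup [set g a | a in A].

Definition min_over (R : realType) (T : Type) (A : set T) (g : T -> R) : R :=
  inf [set g a | a in A].

(* The norm of 'rV[R]_n is the sup norm; all norms on R^n being equivalent,
   coercivity does not depend on this choice. *)
Definition coercive (R : realType) (n : nat) (g : 'rV[R]_n -> R) :=
  forall M : R, exists r : R, forall x, r < `|x| -> M < g x.

Definition W (R : realType) (dx dy : nat) (Y : set 'rV[R]_dy) :
    set ('I_dx.+1 -> 'rV[R]_dy) :=
  [set w | forall i, Y (w i)].
Arguments W {R} dx {dy} Y.

Definition F (R : realType) (dx dy : nat) (f : 'rV[R]_dx -> 'rV[R]_dy -> R)
    (x : 'rV[R]_dx) (w : 'I_dx.+1 -> 'rV[R]_dy) : R :=
  \big[Num.max/f x (w ord0)]_(i < dx.+1) f x (w i).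

Definition G (R : realType) (dx dy : nat) (X : set 'rV[R]_dx)
    (f : 'rV[R]_dx -> 'rV[R]_dy -> R) (w : 'I_dx.+1 -> 'rV[R]_dy) : R :=
  min_over X (fun x => F f x w).

(* Main.v *)
Require Import Defs.
From HB Require Import structures.
From mathcomp Require Import all_boot all_order all_algebra finmap.
From mathcomp Require Import boolp classical_sets reals topology normedtype.
From mathcomp Require Import convex interval_inference cardinality.

Set Implicit Arguments.
Unset Strict Implicit.
Unset Printing Implicit Defensive.

Import Order.TTheory GRing.Theory Num.Theory.
Import numFieldNormedType.Exports.

Local Open Scope classical_set_scope.
Local Open Scope ring_scope.

(** Write Phi x for the maximum of [f x] over Y and c for the maximum of
    [G X f] over the tuples of points of Y.  That c is at most the minimum of
    Phi is the trivial half, since a tuple only sees finitely many points of Y: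
    [F f x w <= Phi x].  The other half is Helly's theorem.  For y in Y the
    sublevel set C_y = {x in X | f x y <= c} is convex because X and
    [f^~ y] are, and compact because [f^~ y] is continuous and coercive.  Any
    dx+1 of these sets C_(w i) have a common point, namely a minimiser over X
    of [F f ^~ w], whose value is [G X f w <= c].  By Helly's theorem in
    dimension dx, extended from finite to arbitrary families by compactness
    ([helly_compact]), all the C_y share a point x.  Then Phi x <= c, so that
    the minimum of Phi is at most c.

    The argument works at the level c itself, rather than at levels approaching
    it, because the extrema are attained.  In each case the function to be
    minimised is a supremum of continuous functions (for the maximum of
    [G X f], an infimum of the continuous functions [F f x], read with the
    opposite sign), hence has closed sublevel sets, here even compact ones, and
    [compact_sublevel_attains_min] applies. *)

(** * Helly's theorem *)

Section Helly.
Variable R : realType.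

(** Weights are only required to have a positive sum, and the barycenter is
    normalised afterwards: this is the form in which the two halves of an
    affine dependence present themselves.  The binary axiom of convexity
    suffices because the pairs (total weight s, weighted sum v) with v / s in A,
    together with (0, 0), are closed under addition. *)
Lemma convex_barycenter (M : lmodType R) (A : set M)
    (J : finType) (P : pred J) (a : J -> R) (x : J -> M) :
  convex_set A -> (forall j, P j -> 0 <= a j) ->
  (forall j, P j -> A (x j)) -> 0 < \sum_(j | P j) a j ->
  A ((\sum_(j | P j) a j)^-1 *: \sum_(j | P j) a j *: x j).
Proof.
move=> cA a_ge0 Ax.
pose K s (v : M) := (s = 0 /\ v = 0) \/ (0 < s /\ A (s^-1 *: v)).
have KD s v s' v' : K s v -> K s' v' -> K (s + s') (v + v').
  case=> [[-> ->]|[s0 Av]]; first by rewrite !add0r.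
  case=> [[-> ->]|[s'0 Av']]; first by rewrite !addr0; right.
  have ss0 : 0 < s + s' by rewrite addr_gt0.
  right; split=> //.
  have t01 : 0 <= s / (s + s') <= 1.
    by rewrite divr_ge0 ?(ltW s0) ?(ltW ss0)//= ler_pdivrMr// mul1r lerDl ltW.
  have /set_mem := cA _ _ (Itv01 (andP t01).1 (andP t01).2) (mem_set Av)
    (mem_set Av').
  congr (A _); rewrite /conv/= /unstable.onem scalerDr !scalerA.
  congr (_ *: _ + _ *: _).
    by rewrite mulrAC divff ?gt_eqF// mul1r.
  rewrite -[X in X - _](@divff _ (s + s')) ?gt_eqF// -mulrBl addrAC subrr add0r.
  by rewrite mulrAC divff ?gt_eqF// mul1r.
have : K (\sum_(j | P j) a j) (\sum_(j | P j) a j *: x j).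
  apply: (big_ind2 K) => [|s v s' v'|j Pj]; [by left|exact: KD|].
  have [->|aj0] := eqVneq (a j) 0; first by left; rewrite scale0r.
  right; rewrite lt_neqAle eq_sym aj0 a_ge0//; split=> //.
  by rewrite scalerA mulVf// scale1r; exact: Ax.
by case=> [[->]|[]//]; rewrite ltxx.
Qed.

(** In the matrix with rows (x_j, 1), there are more rows than columns, so
    the rows are linearly dependent; the last column says that the coefficients
    sum to zero.  Being nonzero with zero sum, they cannot all be
    nonpositive. *)
Lemma affine_dependence (n m : nat) (x : 'I_m -> 'rV[R]_n) : (n.+1 < m)%N ->
  exists a : 'I_m -> R, [/\ exists j, 0 < a j, \sum_j a j = 0 &
    \sum_j a j *: x j = 0].
Proof.
move=> nm.
pose A : 'M[R]_(m, n + 1) := row_mx (\matrix_j x j) (const_mx 1).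
have : kermx A != 0.
  rewrite -mxrank_eq0 mxrank_ker subn_eq0 -ltnNge.
  by rewrite (leq_ltn_trans (rank_leq_col A))// addn1.
case/rowV0Pn => u /sub_kermxP; rewrite mul_mx_row.
rewrite -[RHS]row_mx0 => /eq_row_mx [ux0 u1] u_neq0.
have sum0 : \sum_j u 0 j = 0.
  have /rowP/(_ 0) := u1; rewrite !mxE => {}u1; rewrite -[RHS]u1.
  by apply: eq_bigr => j _; rewrite mxE mulr1.
have sumx0 : \sum_j u 0 j *: x j = 0.
  rewrite -[RHS]ux0 mulmx_sum_row; apply: eq_bigr => j _.
  by rewrite rowK.
exists (u 0); split=> //.
apply: contrapT => /forallNP u_le0; move/eqP: u_neq0; apply.
apply/rowP => j; rewrite mxE; apply/eqP; rewrite -oppr_eq0.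
have/(_ sum0) : \sum_j u 0 j = 0 -> \sum_j (- u 0 j) = 0.
  by rewrite sumrN => ->; rewrite oppr0.
move/psumr_eq0P => ->// i _; rewrite oppr_ge0 leNgt; exact/negP/u_le0.
Qed.

(** Helly's theorem by Radon's argument.  Given more than n+1 sets, let x_j be a
    common point of all of them but the j-th, and take an affine dependence
    between the x_j.  Moving the nonpositive coefficients to the other side and
    normalising gives one point z that is a barycenter both of the x_j with
    positive coefficient and of the other x_j.  A set with index i contains
    every x_j of the half in which i does not lie, hence contains z. *)
Lemma helly_finite (n : nat) (J : Type) (D : set J) (C : J -> set 'rV[R]_n) :
  (forall i, D i -> convex_set (C i)) ->
  (forall w : 'I_n.+1 -> J, (forall k, D (w k)) -> \bigcap_k C (w k) !=set0) ->
  forall m (w : 'I_m -> J), (forall k, D (w k)) -> \bigcap_k C (w k) !=set0.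
Proof.
move=> cC meet; elim=> [|m IHm] w Dw; first by exists 0 => -[].
have [mn|nm] := leqP m n.
  (* At most n+1 sets: the last one is repeated to make up exactly n+1. *)
  have [x Cx] := meet (fun k => w (inord (minn k m))) (fun=> Dw _).
  exists x => k _; have := Cx (inord k) I; rewrite inordK; last first.
    by rewrite (leq_trans (ltn_ord k)).
  by rewrite (minn_idPl _) ?inord_val// -ltnS.
have /choice[x Cx] : forall j, exists x, forall i, i != j -> C (w i) x.
  move=> j; have [x Cx] := IHm (w \o lift j) (fun=> Dw _).
  exists x => i; case: (unliftP j i) => [k ->|->]; last by rewrite eqxx.
  by move=> _; exact: (Cx k).
have [a [[j0 aj0] suma0 sumax0]] := affine_dependence x (nm : n.+1 < m.+1)%N.
have s_gt0 : 0 < \sum_(j | 0 < a j) a j.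
  by rewrite (bigD1 j0)//= ltr_pwDl// sumr_ge0// => j /andP[/ltW].
have sN : \sum_(j | 0 < a j) a j = \sum_(j | ~~ (0 < a j)) - a j.
  apply/eqP; rewrite sumrN -addr_eq0 -[X in _ == X]suma0.
  by rewrite [in eqbRHS](bigID (fun j => 0 < a j)).
have zN : \sum_(j | 0 < a j) a j *: x j = \sum_(j | ~~ (0 < a j)) - a j *: x j.
  under [RHS]eq_bigr do rewrite scaleNr.
  apply/eqP; rewrite sumrN -addr_eq0 -[X in _ == X]sumax0.
  by rewrite [in eqbRHS](bigID (fun j => 0 < a j)).
exists ((\sum_(j | 0 < a j) a j)^-1 *: \sum_(j | 0 < a j) a j *: x j) => i _.
have [ai0|ai0] := boolP (0 < a i).
  rewrite zN sN; apply: convex_barycenter; first exact: cC.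
  - by move=> j; rewrite -leNgt oppr_ge0.
  - by move=> j aj; apply: Cx; apply: contraNneq aj => <-.
  - by rewrite -sN.
apply: convex_barycenter => //; first exact: cC.
- by move=> j /ltW.
- by move=> j aj; apply: Cx; apply: contraNneq ai0 => ->.
Qed.

(** Finite subfamilies meet by [helly_finite]; compactness does the rest, one
    member of the family serving as the ambient compact set. *)
Lemma helly_compact (n : nat) (J : choiceType) (D : set J)
    (C : J -> set 'rV[R]_n) :
  D !=set0 -> (forall i, D i -> convex_set (C i)) ->
  (forall i, D i -> compact (C i)) ->
  (forall w : 'I_n.+1 -> J, (forall k, D (w k)) -> \bigcap_k C (w k) !=set0) ->
  \bigcap_(i in D) C i !=set0.
Proof.
move=> [i0 Di0] cC kC meet.
have := kC _ Di0; rewrite compact_In0 => /(_ J D (fun i => C i0 `&` C i)).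
case=> [||x Cx].
- exists C => // i Di; apply: compact_closed (kC _ Di).
  exact: norm_hausdorff.
- move=> E ED.
  (* The index i0 of the ambient compact set joins the finite subfamily. *)
  pose s := i0 :: enum_fset E.
  have [k|x Cx] := helly_finite cC meet (w := tnth (in_tuple s)).
    have := mem_tnth k (in_tuple s); rewrite inE => /orP[/eqP ->//|kE].
    exact/set_mem/ED.
  exists x => i /= iE; split.
    exact: (Cx ord0).
  have /tnthP[k ->] : i \in in_tuple s by rewrite inE /= iE orbT.
  exact: Cx.
- by exists x => i Di; have [] := Cx _ Di.
Qed.

End Helly.

(** * Attained extrema *)

Section Extrema.
Variable R : realType.

(** Weierstrass' theorem for lower semicontinuous functions.  The nonempty
    sublevel sets of g are nested, so they generate a proper filter; a cluster
    point of it lies in all of them, that is, minimises g.  Separation makes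
    the compact sublevel sets closed. *)
Lemma compact_sublevel_attains_min (T : topologicalType) (A : set T)
    (g : T -> R) : hausdorff_space T -> A !=set0 ->
  (forall c, compact (A `&` [set t | g t <= c])) -> attains_min A g.
Proof.
move=> hT [a0 Aa0] kg.
pose S a := A `&` [set t | g t <= g a].
have FP : ProperFilter (filter_from A S).
  apply: filter_from_proper; last by move=> a Aa; exists a; split=> /=.
  apply: filter_from_filter; first by exists a0.
  move=> a b Aa Ab; have [gab|gba] := leP (g a) (g b).
    exists a => // t [At ta]; split; split=> //=; exact: le_trans gab.
  exists b => // t [At tb]; split; split=> //=; exact: le_trans (ltW gba).
have FS a : A a -> filter_from A S (S a) by move=> Aa; exists a.
have [p [[Ap _] clp]] := kg (g a0) _ FP (FS _ Aa0).
exists p => // b Ab; suff [] : S b p by [].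
apply: (compact_closed hT (kg (g b))) => B pB.
exact: clp (FS _ Ab) pB.
Qed.

Lemma attains_max_oppr (T : Type) (A : set T) (g : T -> R) :
  attains_min A (\- g) -> attains_max A g.
Proof. by move=> [a Aa ga]; exists a => // b /ga; rewrite lerN2. Qed.

(** An attained maximum is characterised by its upper bounds, an attained
    minimum by its lower bounds; these equivalences are what turns sublevel
    sets of a supremum into intersections of sublevel sets. *)
Lemma max_over_le (T : Type) (A : set T) (g : T -> R) c :
  attains_max A g -> (max_over A g <= c) <-> (forall a, A a -> g a <= c).
Proof.
move=> [a Aa ga]; split=> [gc b Ab|gc].
  apply: le_trans gc; apply: ub_le_sup; last by exists b.
  by exists (g a) => _ [d /ga + <-].
by apply: ge_sup => [|_ [b /gc + <-]//]; exists (g a), a.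
Qed.

Lemma min_over_ge (T : Type) (A : set T) (g : T -> R) c :
  attains_min A g -> (c <= min_over A g) <-> (forall a, A a -> c <= g a).
Proof.
move=> [a Aa ga]; split=> [gc b Ab|gc].
  apply: le_trans gc _; apply: ge_inf; last by exists b.
  by exists (g a) => _ [d /ga + <-].
by apply: lb_le_inf => [|_ [b /gc + <-]//]; exists (g a), a.
Qed.

Lemma min_over_attained (T : Type) (A : set T) (g : T -> R) :
  attains_min A g -> exists2 a, A a & min_over A g = g a.
Proof.
move=> mg; have [a Aa ga] := mg; exists a => //; apply/eqP.
by rewrite eq_le (min_over_ge _ mg).1//=; exact/(min_over_ge _ mg).
Qed.

Lemma max_over_attained (T : Type) (A : set T) (g : T -> R) :
  attains_max A g -> exists2 a, A a & max_over A g = g a.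
Proof.
move=> mg; have [a Aa ga] := mg; exists a => //; apply/eqP.
rewrite eq_le [X in _ && X](max_over_le _ mg).1// andbT.
exact/(max_over_le _ mg).
Qed.

End Extrema.

(** * Sublevel sets of the payoff *)

Lemma continuous_partial1 (T U V : topologicalType) (h : T * U -> V) y :
  continuous h -> continuous (fun x => h (x, y)).
Proof.
move=> ch x; apply: (@cvg_comp _ _ _ (fun x => (x, y)) h _ (nbhs (x, y)));
  last exact: ch.
exact: (cvg_pair cvg_id (cvg_cst y)).
Qed.

Lemma continuous_partial2 (T U V : topologicalType) (h : T * U -> V) x :
  continuous h -> continuous (fun y => h (x, y)).
Proof.
move=> ch y; apply: (@cvg_comp _ _ _ (fun y => (x, y)) h _ (nbhs (x, y)));
  last exact: ch.
exact: (cvg_pair (cvg_cst x) cvg_id).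
Qed.

Section Payoff.
Variables (R : realType) (dx dy : nat).
Variables (X : set 'rV[R]_dx) (Y : set 'rV[R]_dy).
Variable f : 'rV[R]_dx -> 'rV[R]_dy -> R.

Lemma F_le x w c : F f x w <= c <-> forall i, f x (w i) <= c.
Proof.
split=> [/bigmax_leP[_ le_c] i|le_c]; first exact: le_c.
by apply/bigmax_leP; split=> [|i _]; exact: le_c.
Qed.

Lemma F_ge x w c : c <= F f x w <-> exists i, c <= f x (w i).
Proof.
split=> [|[i ci]]; last first.
  by apply: le_trans ci _; exact: ((F_le x w _).1 (lexx _) i).
apply: contraPP => /forallNP ltc; apply/negP; rewrite -ltNge.
by apply/bigmax_ltP; split=> [|i _]; rewrite ltNge; exact/negP/ltc.
Qed.

Hypothesis f_continuous :
  continuous (fun z : 'rV[R]_dx * 'rV[R]_dy => f z.1 z.2).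

Lemma continuous_fst_arg y : continuous (f^~ y).
Proof. exact: (continuous_partial1 f_continuous). Qed.

Lemma continuous_snd_arg x : continuous (f x).
Proof. exact: (continuous_partial2 f_continuous). Qed.

(** With D = Y this is a sublevel set on X of the maximum of [f x] over Y, with
    D the range of a tuple w a sublevel set of [F f ^~ w], and with D a
    singleton one of the sets to which Helly's theorem is applied.  A single
    coercive function already bounds the intersection. *)
Lemma compact_common_sublevel (D : set 'rV[R]_dy) c :
  closed X -> D !=set0 -> (forall y, D y -> coercive (f^~ y)) ->
  compact (X `&` \bigcap_(y in D) [set x | f x y <= c]).
Proof.
move=> clX [y0 Dy0] coer; apply: bounded_closed_compact.
  have [r rP] := coer _ Dy0 c.
  exists r; split; first exact: num_real.
  move=> s rs x [_ /(_ _ Dy0) /= fxc].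
  rewrite leNgt; apply/negP => sx.
  by have := rP x (lt_trans rs sx); rewrite ltNge fxc.
apply: closedI => //; apply: closed_bigI => y _.
apply: (@preimage_closed _ _ (f^~ y) [set z | z <= c]); last exact: closed_le.
by move=> x _; exact: continuous_fst_arg.
Qed.

Lemma compact_W : compact Y -> @compact (prod_topology _) (W dx Y).
Proof. by move=> kY; apply: (@tychonoff _ _ (fun=> Y)). Qed.

(** A finite maximum is at least c exactly when one of its terms is, so the set
    is a finite union of closed sets. *)
Lemma closed_F_ge x c :
  @closed (prod_topology (fun _ : 'I_dx.+1 => 'rV[R]_dy))
    [set w | c <= F f x w].
Proof.
have -> : [set w | c <= F f x w] =
    \bigcup_(i in [set: 'I_dx.+1]) [set w | c <= f x (w i)].
  apply/seteqP; split=> w /=; first by move=> /F_ge[i]; exists i.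
  by move=> [i _ ci]; apply/F_ge; exists i.
apply: closed_bigcup => [|i _]; first exact: finite_finset.
apply: (@preimage_closed (prod_topology (fun _ : 'I_dx.+1 => 'rV[R]_dy)) _
  (fun w => f x (w i)) [set z | c <= z]); last exact: closed_ge.
move=> w _; apply: (@continuous_comp (prod_topology _) _ _
  (fun w => w i) (f x)).
  exact: proj_continuous.
exact: continuous_snd_arg.
Qed.

End Payoff.

Lemma convex_sublevel (R : realType) (M : lmodType R) (A : set M)
    (g : M -> R) c :
  convex_set A -> @convex_function R M setT g ->
  @convex_set R M (A `&` [set x | g x <= c]).
Proof.
move=> cA cg x y t /set_mem[Ax gx] /set_mem[Ay gy]; apply/mem_set; split.
  by apply/set_mem/cA; exact/mem_set.
apply: le_trans (cg t x y (in_setT _) (in_setT _)) _.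
have /andP[t0 t1] : 0 <= t%:num <= 1 by apply/andP.
rewrite convRE /unstable.onem.
have -> : c = t%:num * c + (1 - t%:num) * c.
  by rewrite -mulrDl addrC subrK mul1r.
by rewrite lerD// ler_wpM2l// subr_ge0.
Qed.

(** * Minimax through tuples of dx+1 points *)

Theorem proposition2p1 (R : realType) (dx dy : nat)
    (X : set 'rV[R]_dx) (Y : set 'rV[R]_dy)
    (f : 'rV[R]_dx -> 'rV[R]_dy -> R)
    (X_nonempty : X !=set0) (X_closed : closed X) (X_convex : convex_set X)
    (Y_nonempty : Y !=set0) (Y_compact : compact Y)
    (f_continuous :
      continuous (fun z : 'rV[R]_dx * 'rV[R]_dy => f z.1 z.2))
    (f_coercive : forall y, Y y -> coercive (f^~ y))
    (f_convex : forall y, Y y ->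
      @convex_function R 'rV[R]_dx setT (f^~ y)) :
  [/\ forall x, X x -> attains_max Y (f x),
      attains_min X (fun x => max_over Y (f x)),
      forall w, W dx Y w -> attains_min X (fun x => F f x w),
      attains_max (W dx Y) (G X f) &
      min_over X (fun x => max_over Y (f x))
        = max_over (W dx Y) (G X f) /\
      max_over (W dx Y) (G X f)
        = max_over (W dx Y)
            (fun w => min_over X (fun x => F f x w))].
Proof.
have maxY x : attains_max Y (f x).
  apply/attains_max_oppr/compact_sublevel_attains_min => // c.
  apply: compact_closedI => //.
  apply: (@preimage_closed _ _ (\- f x) [set z | z <= c]);
    last exact: closed_le.
  by move=> y _; apply: continuousN; exact: continuous_snd_arg.
have minPhi : attains_min X (fun x => max_over Y (f x)).
  apply: compact_sublevel_attains_min => // c.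
  rewrite [X in compact X](_ : _ = X `&` \bigcap_(y in Y) [set x | f x y <= c]).
    exact: compact_common_sublevel.
  by congr (_ `&` _); apply/seteqP; split=> x /(max_over_le _ (maxY x)).
have minF w : W dx Y w -> attains_min X (fun x => F f x w).
  move=> Yw; apply: compact_sublevel_attains_min => // c.
  rewrite [X in compact X](_ : _ =
      X `&` \bigcap_(y in range w) [set x | f x y <= c]).
    apply: compact_common_sublevel => //; first by exists (w ord0), ord0.
    by move=> _ [i _ <-]; exact/f_coercive/Yw.
  congr (_ `&` _); apply/seteqP; split=> x /=.
    by move=> /F_le le_c _ [i _ <-]; exact: le_c.
  by move=> le_c; apply/F_le => i; apply: le_c; exists i.
have maxG : attains_max (W dx Y) (G X f).
  apply: attains_max_oppr.
  apply: (@compact_sublevel_attains_min _ (prod_topology _)) => [| |c].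
  - by apply: hausdorff_product => i; exact: norm_hausdorff.
  - by have [y Yy] := Y_nonempty; exists (fun=> y) => i.
  - rewrite [X in compact X](_ : _ =
        W dx Y `&` \bigcap_(x in X) [set w | - c <= F f x w]).
      apply: compact_closedI; first exact: compact_W.
      by apply: closed_bigI => x _; exact: closed_F_ge.
    apply/seteqP; split=> w [Yw /= Gc]; split=> //=.
      by apply/(min_over_ge _ (minF w Yw)); rewrite lerNl.
    by rewrite lerNl; apply/(min_over_ge _ (minF w Yw)).
split=> //; split=> //.
have [x0 Xx0 Vx0] := min_over_attained minPhi.
have [w0 Yw0 Gw0] := max_over_attained maxG.
apply/eqP; rewrite eq_le; apply/andP; split; last first.
  rewrite Gw0 Vx0.
  apply: le_trans ((min_over_ge _ (minF w0 Yw0)).1 (lexx _) x0 Xx0) _.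
  by apply/F_le => i; exact: (max_over_le _ (maxY x0)).1.
set c := max_over _ (G X f).
have [|y Yy|y Yy|w Yw|x Cx] := @helly_compact R dx _ Y
    (fun y => X `&` [set x | f x y <= c]).
- exact: Y_nonempty.
- by apply: convex_sublevel => //; exact: f_convex.
- have := @compact_common_sublevel R dx dy X f f_continuous [set y] c.
  rewrite bigcap_set1; apply => //; first by exists y.
  by move=> _ ->; exact: f_coercive.
- have [x Xx Gx] := min_over_attained (minF w Yw).
  exists x => i _; split=> //=; apply: (F_le f x w c).1 => //.
  by rewrite -Gx; exact: (max_over_le _ maxG).1.
have Xx : X x by have [y Yy] := Y_nonempty; have [] := Cx y Yy.
apply: le_trans ((min_over_ge _ minPhi).1 (lexx _) x Xx) _.
by apply/(max_over_le _ (maxY x)) => y Yy; have [] := Cx y Yy.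
Qed.
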